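(* Let $Z\ge 1$ be an integer, $p\in[0,1]$ and $W>0$. If $(n_1,\dots,n_m)$ is an optimal class size vector for the school with parameters $Z,p,W$, then the class sizes $n_1,\dots,n_m$ are nearly equal, i.e. $\max_i n_i-\min_i n_i\le 1$.
   Context: A class size vector with $m\ge 1$ classes for a school of $Z$ students is a tuple $(n_1,\dots,n_m)$ of positive integers with $\sum_{i=1}^m n_i=Z$. Here $p$ is the probability that a student is not disrupting the class and $W$ is the cost of a teacher (relative to the value of a unit of learning, which is normalized to $1$). The profit of $(n_1,\dots,n_m)$ is $\sum_{i=1}^m n_i p^{n_i}-mW$. A class size vector is optimal if it maximizes the profit over all $m\ge 1$ and all class size vectors with $m$ classes; by convention, if the maximum profit is attained for several numbers of classes $m$, only the least such $m$ is regarded as optimal (so an optimal class size vector has that number of components). *)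

(* Defs.v *)
From mathcomp Require Import all_boot all_order all_algebra.
From mathcomp Require Import reals.

Set Implicit Arguments.
Unset Strict Implicit.
Unset Printing Implicit Defensive.

Import Order.TTheory GRing.Theory Num.Theory.

Local Open Scope ring_scope.

Definition class_size_vector (Z m : nat) (n : m.-tuple nat) : Prop :=
  [/\ (1 <= m)%N,
      (forall i : 'I_m, (0 < tnth n i)%N)
    & (\sum_(i < m) tnth n i)%N = Z].

Definition profit (R : realType) (p W : R) (m : nat) (n : m.-tuple nat) : R :=
  \sum_(i < m) (tnth n i)%:R * p ^+ tnth n i - m%:R * W.

(* The last clause is the tie-breaking convention: among the numbers of classes
   for which the maximum profit is attained, only the least one is optimal. *)
Definition optimal (R : realType) (Z : nat) (p W : R)
    (m : nat) (n : m.-tuple nat) : Prop :=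
  [/\ class_size_vector Z n,
      (forall (m' : nat) (n' : m'.-tuple nat),
         class_size_vector Z n' -> profit p W n' <= profit p W n)
    & (forall (m' : nat) (n' : m'.-tuple nat),
         class_size_vector Z n' -> profit p W n' = profit p W n -> (m <= m')%N)].

Definition max_size (m : nat) (n : m.-tuple nat) : nat :=
  (\max_(i < m) tnth n i)%N.

(* The seed [max_size n] of the iterated minimum is at least every entry, so for
   [1 <= m] it does not affect the value; it also ensures
   [min_size n <= max_size n], so that the natural-number subtraction
   [max_size n - min_size n] is never truncated. *)
Definition min_size (m : nat) (n : m.-tuple nat) : nat :=
  \big[minn/max_size n]_(i < m) tnth n i.

Definition nearly_equal (m : nat) (n : m.-tuple nat) : Prop :=
  (max_size n - min_size n <= 1)%N.

(* Main.v *)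
Require Import Defs.
From mathcomp Require Import all_boot all_order all_algebra.
From mathcomp Require Import reals.
From mathcomp Require Import ring lra zify.
From mathcomp Require Import topology normedtype.
From mathcomp Require Import sequences derive exp.

Import Order.TTheory GRing.Theory Num.Theory.
Import numFieldNormedType.Exports.

Local Open Scope ring_scope.

(** Suppose that a profit-maximizing school has classes of sizes [a] and [b]
    with [b + 2 <= a]. Only the students of these two classes are reassigned,
    and three reassignments already contradict each other.

    If [p = 0] or [p = 1], merging the two classes saves a teacher and loses no
    learning. Otherwise put [p = exp (- w)] and measure class sizes in units of
    [1 / w]: up to the factor [w], a class of scaled size [x] learns
    [yield x = x * exp (- x)]. Write [a * w = M + H] and [b * w = M - H], so
    that [w <= H < M].

    - Moving a student from the large to the small class does not help. Since
      [yield (M - H) + yield (M + H)] is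
      [2 * exp (- M) * (M * cosh H - H * sinh H)], and this decreases in the
      half-gap [H] as long as [M <= 2], it follows that [2 <= M]
      ([spread_preferred_mean_ge2]): the classes are too large on average.
    - Merging the two classes does not help, so the teacher's cost is at most
      what the second class adds to the learning, namely
      [yield (M - H) + yield (M + H) - yield (2 * M)] after scaling.
    - Hiring one more teacher for the same students does not help either, so
      the teacher's cost is at least what a third class can add.

    The last two bounds are incompatible when [2 <= M]. If the gap is wide,
    [1 / 2 <= H], the third class comes from cutting the large class [a] into
    [b] and [a - b] ([split_beats_merge_of_spread]). If it is narrow,
    [H <= 1 / 2], cutting only one class does not always suffice, and all
    [a + b] students are distributed into three nearly equal classes
    ([three_classes_beat_merge_of_close]); the loss caused by rounding to
    integers is controlled by convexity of the exponential
    ([jensen_three_yields]). The combination of these facts is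
    [uneven_pair_improvable]. *)

(** * Hyperbolic functions and bounds for the exponential *)

Definition sinh {R : realType} (x : R) : R := (expR x - expR (- x)) / 2.
Definition cosh {R : realType} (x : R) : R := (expR x + expR (- x)) / 2.

Lemma is_derive_nondecreasing (R : realType) (f df : R -> R) :
  (forall x : R, is_derive x (1 : R) f (df x)) -> (forall x, 0 <= x -> 0 <= df x) ->
  forall x y, 0 <= x -> x <= y -> f x <= f y.
Proof.
move=> fdf df0; apply: ger0_derive1_ndecry.
- by move=> x _; case: (fdf x).
- move=> x; rewrite in_itv/= andbT => /ltW x0.
  by rewrite derive1E (@derive_val _ _ _ _ _ _ _ (fdf x)) df0.
- apply: continuous_subspaceT => x.
  by apply/differentiable_continuous/derivable1_diffP; case: (fdf x).
Qed.

Lemma is_derive_sinh (R : realType) (x : R) : is_derive x (1 : R) sinh (cosh x).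
Proof.
rewrite /sinh; apply: is_derive_eq.
by rewrite /cosh scaler0 add0r /GRing.scale/=; ring.
Qed.

Lemma is_derive_cosh (R : realType) (x : R) : is_derive x (1 : R) cosh (sinh x).
Proof.
rewrite /cosh; apply: is_derive_eq.
by rewrite /sinh scaler0 add0r /GRing.scale/=; ring.
Qed.

#[local] Existing Instance is_derive_sinh.
#[local] Existing Instance is_derive_cosh.

Lemma sinh0 (R : realType) : sinh (0 : R) = 0.
Proof. by rewrite /sinh oppr0 subrr mul0r. Qed.

Lemma cosh0 (R : realType) : cosh (0 : R) = 1.
Proof. by rewrite /cosh oppr0 expR0; lra. Qed.

Lemma sinh_ge0 (R : realType) (x : R) : 0 <= x -> 0 <= sinh x.
Proof.
move=> x0; have : expR (- x) <= expR x by rewrite ler_expR; lra.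
by rewrite /sinh; lra.
Qed.

Lemma cosh_lt (R : realType) (x y : R) : 0 <= x -> x < y -> cosh x < cosh y.
Proof.
move=> x0 xy.
have Ex : 1 <= expR x by rewrite -expR0 ler_expR.
have Exy : expR x < expR y by rewrite ltr_expR.
rewrite /cosh !expRN.
have -> : (expR y + (expR y)^-1) / 2 = (expR x + (expR x)^-1) / 2 +
   (expR y - expR x) * (expR x * expR y - 1) / (2 * expR x * expR y).
  by field; rewrite !expR_eq0.
rewrite ltrDl divr_gt0 //; last by rewrite !mulr_gt0 ?expR_gt0.
by rewrite mulr_gt0; nra.
Qed.

Lemma sinh_le_mul_cosh (R : realType) (x : R) : 0 <= x -> sinh x <= x * cosh x.
Proof.
move=> x0; rewrite -subr_ge0.
have := @is_derive_nondecreasing R (fun t => t * cosh t - sinh t)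
          (fun t => t * sinh t) _ _ 0 x (lexx _) x0.
rewrite sinh0 mul0r subr0; apply.
- move=> t; apply: is_derive_eq.
  by rewrite /GRing.scale/=; ring.
- by move=> t t0; rewrite mulr_ge0 ?sinh_ge0.
Qed.

(** The derivative is [x * cosh x - sinh x]. This monotonicity is exactly what
    compares two splittings of [2 * M] students at the critical value [M = 2],
    and at [x = 0] it gives [2 * cosh y <= 2 + y * sinh y]. *)
Lemma mul_sinh_sub_cosh_le (R : realType) (x y : R) : 0 <= x -> x <= y ->
  x * sinh x - 2 * cosh x <= y * sinh y - 2 * cosh y.
Proof.
apply: (@is_derive_nondecreasing R (fun t => t * sinh t - 2 * cosh t)
          (fun t => t * cosh t - sinh t)).
- move=> t; apply: is_derive_eq.
  by rewrite /GRing.scale/=; ring.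
- by move=> t t0; rewrite subr_ge0 sinh_le_mul_cosh.
Qed.

Lemma expR_ge_quadratic (R : realType) (x : R) : 0 <= x ->
  1 + x + x ^+ 2 / 2 <= expR x.
Proof.
move=> x0; rewrite -subr_ge0.
have := @is_derive_nondecreasing R (fun t => expR t - (1 + t + t ^+ 2 / 2))
          (fun t => expR t - (1 + t)) _ _ 0 x (lexx _) x0.
rewrite expR0 expr0n /= mul0r !addr0 subrr; apply.
- move=> t; apply: is_derive_eq.
  by rewrite /GRing.scale/=; field.
- by move=> t _; rewrite subr_ge0 expR_ge1Dx.
Qed.

Lemma expR_ge_cubic (R : realType) (x : R) : 0 <= x ->
  1 + x + x ^+ 2 / 2 + x ^+ 3 / 6 <= expR x.
Proof.
move=> x0; rewrite -subr_ge0.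
have := @is_derive_nondecreasing R
  (fun t => expR t - (1 + t + t ^+ 2 / 2 + t ^+ 3 / 6))
  (fun t => expR t - (1 + t + t ^+ 2 / 2)) _ _ 0 x (lexx _) x0.
rewrite expR0 !expr0n /= !mul0r !addr0 subrr; apply.
- move=> t; apply: is_derive_eq.
  by rewrite /GRing.scale/=; field.
- by move=> t t0; rewrite subr_ge0 expR_ge_quadratic.
Qed.

(** * Scaled learning in one, two and three classes *)

Definition yield {R : realType} (x : R) : R := x * expR (- x).

Lemma yield_pair (R : realType) (M H : R) :
  yield (M - H) + yield (M + H) = 2 * expR (- M) * (M * cosh H - H * sinh H).
Proof.
rewrite /yield /cosh /sinh !opprD opprK !expRD.
by field.
Qed.

(** Below mean [2] the more equal pair learns more: adding
    [mul_sinh_sub_cosh_le] to the comparison of the two pairs leaves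
    [0 <= (M - 2) * (cosh H - cosh H')]. *)
Lemma spread_preferred_mean_ge2 (R : realType) (M H H' : R) :
  0 <= H' -> H' < H ->
  yield (M - H') + yield (M + H') <= yield (M - H) + yield (M + H) -> 2 <= M.
Proof.
move=> H'0 H'H; rewrite !yield_pair ler_pM2l; last first.
  by rewrite mulr_gt0 ?expR_gt0.
have G := mul_sinh_sub_cosh_le _ _ _ H'0 (ltW H'H).
have C := cosh_lt _ _ _ H'0 H'H.
move=> le.
rewrite -subr_ge0 -(pmulr_lge0 (M - 2) (_ : 0 < cosh H - cosh H')); last lra.
by nra.
Qed.

(** With [A = M + H] and [B = M - H], a strict midpoint-convexity inequality for
    [yield] at [A] with step [B]: cutting [A] into [B] and [A - B] adds more
    learning than is lost by merging [A] and [B]. After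
    division by [exp (- A)] the difference factors, and what remains is
    [B + H < H * exp B]; this holds because [B] is at least [2 - H]. *)
Lemma split_beats_merge_of_spread (R : realType) (M H : R) :
  2 <= M -> 1 / 2 <= H -> H < M ->
  2 * yield (M + H) < yield (2 * H) + yield (2 * M).
Proof.
move=> M2 H2 HM; have [B defB] : exists B, B = M - H by exists (M - H).
have B0 : 0 < B by rewrite defB; lra.
have BH : 2 - H <= B by rewrite defB; lra.
have key : B + H < H * expR B.
  have [H1|H1] := lerP 1 H.
    have : 1 + B < expR B by apply: expR_gt1Dx; rewrite gt_eqF.
    by nra.
  have cub := expR_ge_cubic _ _ (ltW B0).
  (* The cubic bound turns the claim into [1 < H * (1 + B / 2 + B ^+ 2 / 6)],
     whose right side is smallest at [B = 2 - H] and [H = 1 / 2], where it is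
     [17 / 16]. The quadratic bound would not be enough there. *)
  have h1 : 1 + (2 - H) / 2 + (2 - H) ^+ 2 / 6 <= 1 + B / 2 + B ^+ 2 / 6.
    by nra.
  have h2 : 1 < H * (1 + (2 - H) / 2 + (2 - H) ^+ 2 / 6) by nra.
  have h3 : 1 < H * (1 + B / 2 + B ^+ 2 / 6).
    by apply: lt_le_trans h2 _; rewrite ler_pM2l; lra.
  have h4 : B < B * (H * (1 + B / 2 + B ^+ 2 / 6)) by rewrite ltr_pMr.
  have h5 : H * (1 + B + B ^+ 2 / 2 + B ^+ 3 / 6) <= H * expR B.
    by rewrite ler_pM2l; lra.
  by apply: lt_le_trans h5; lra.
have E1 : 1 < expR B by rewrite expR_gt1.
rewrite -subr_gt0.
suff -> : yield (2 * H) + yield (2 * M) - 2 * yield (M + H) =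
    expR (- (M + H)) / expR B * (2 * (expR B - 1) * (H * expR B - (B + H))).
  rewrite !mulr_gt0 ?invr_gt0 ?expR_gt0 //; lra.
rewrite /yield.
have -> : - (2 * H) = - (M + H) + B by rewrite defB; ring.
have -> : - (2 * M) = - (M + H) - B by rewrite defB; ring.
rewrite !expRD (expRN B) (_ : M = B + H); last by rewrite defB; ring.
by field; rewrite expR_eq0.
Qed.

(** The two sides differ by less than [1 / 200], so the bounds below have to be
    sharp: the cubic one at [5 / 16], and
    [exp (2 * x) <= (1 + x) / (1 - x)], a form of [sinh x <= x * cosh x], at
    [x = 1 / 8]. *)
Lemma expR_numeric (R : realType) : 2 < expR (5 / 8 : R) + expR (- 2 : R).
Proof.
have e1 : (13664 / 10000 : R) <= expR (5 / 16).
  by apply: le_trans (expR_ge_cubic _ _ _); lra.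
have e2 : (7 / 9 : R) <= expR (- (1 / 4)).
  have := sinh_le_mul_cosh R (1 / 8) ltac:(lra).
  rewrite /sinh /cosh expRN.
  have -> : (1 / 4 = 1 / 8 + 1 / 8 :> R) by lra.
  rewrite opprD expRD expRN.
  have := expR_gt0 (1 / 8 : R); set y := expR _ => y0 h.
  have yi : 0 < y^-1 by rewrite invr_gt0.
  have yy : y * y^-1 = 1 by rewrite mulfV // gt_eqF.
  have : 7 * y * y^-1 <= 9 * y^-1 * y^-1 by rewrite ler_pM2r //; lra.
  by rewrite -!mulrA yy; lra.
have -> : (5 / 8 = 2%:R * (5 / 16) :> R) by lra.
have -> : (- 2 = 8%:R * (- (1 / 4)) :> R) by lra.
rewrite (expRM_natl 2) (expRM_natl 8).
have : (13664 / 10000 : R) ^+ 2 <= expR (5 / 16) ^+ 2.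
  by rewrite ler_pXn2r ?nnegrE ?expR_ge0 //; lra.
have : (7 / 9 : R) ^+ 8 <= expR (- (1 / 4)) ^+ 8.
  by rewrite ler_pXn2r ?nnegrE ?expR_ge0 //; lra.
by lra.
Qed.

(** The first term on the right is what three classes of total scaled size
    [2 * M] are guaranteed to learn: [2 * M / 3] would be their common size, and
    [1 / 24] allows for integer rounding. For [M = 2] and [H = 0] the claim is
    [expR_numeric]. A larger [H] does not raise the left side at [M = 2], because
    [2 * cosh H - H * sinh H <= 2], and for larger [M] the three classes gain
    faster than the two. *)
Lemma three_classes_beat_merge_of_close (R : realType) (M H : R) :
  2 <= M -> 0 <= H <= 1 / 2 ->
  2 * (yield (M - H) + yield (M + H)) <
    2 * M * expR (- (2 * M / 3 + 1 / 24)) + yield (2 * M).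
Proof.
move=> M2 /andP[H0 H1].
have C : cosh H <= 1 + H * sinh H / 2.
  have := mul_sinh_sub_cosh_le _ _ _ (lexx 0) H0.
  by rewrite cosh0 sinh0; lra.
have HS : H * sinh H <= 2 / 7.
  have S := sinh_le_mul_cosh _ _ H0.
  have S0 := sinh_ge0 _ _ H0.
  have : H * sinh H <= H ^+ 2 * cosh H by nra.
  have : H ^+ 2 <= 1 / 4 by nra.
  have c0 : 0 < cosh H by rewrite divr_gt0 ?addr_gt0 ?expR_gt0.
  by nra.
have S0 : 0 <= H * sinh H by rewrite mulr_ge0 ?sinh_ge0.
rewrite yield_pair /yield.
(* At [M = 2] the exponents relative to [- M] are [5 / 8] and [- 2]; the
   dependence on [M - 2] is then linearized by [1 + x <= expR x]. *)
have -> : - (2 * M / 3 + 1 / 24) = - M + (5 / 8 + (M - 2) / 3) by lra.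
have -> : - (2 * M) = - M + (- 2 - (M - 2)) by lra.
rewrite !(expRD (- M)) -subr_gt0.
set X := expR (5 / 8 + _); set Y := expR (- 2 - _).
suff key : 2 * (M * cosh H - H * sinh H) < M * (X + Y).
  rewrite [ltRHS](_ : _ =
      2 * expR (- M) * (M * (X + Y) - 2 * (M * cosh H - H * sinh H))).
    by rewrite mulr_gt0 ?subr_gt0 // mulr_gt0 ?expR_gt0.
  by ring.
have hX : expR (5 / 8) * (1 + (M - 2) / 3) <= X.
  by rewrite /X expRD ler_pM2l ?expR_gt0 // expR_ge1Dx.
have hY : expR (- 2) * (1 - (M - 2)) <= Y.
  by rewrite /Y expRD ler_pM2l ?expR_gt0 // expR_ge1Dx.
have N := expR_numeric R.
have e2 : expR (- 2 : R) <= 1 / 3.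
  have : (3 : R) <= expR 2 by have := expR_ge1Dx (2 : R); lra.
  rewrite expRN div1r lef_pV2 ?posrE ?expR_gt0 //.
have hXY : 2 + (M - 2) / 5 < X + Y by nra.
by nra.
Qed.

(** Jensen's inequality for [t |-> exp (- t)] with the class sizes as weights:
    the weighted mean exponent is the sum of squares over the sum. The proof adds
    up the tangent-line bounds at [m]. *)
Lemma jensen_three_yields (R : realType) (x y z m : R) :
  0 <= x -> 0 <= y -> 0 <= z ->
  x ^+ 2 + y ^+ 2 + z ^+ 2 <= (x + y + z) * m ->
  (x + y + z) * expR (- m) <= yield x + yield y + yield z.
Proof.
move=> x0 y0 z0 sq.
have tangent t : 0 <= t -> t * (expR (- m) * (1 + (m - t))) <= yield t.
  move=> t0; rewrite ler_wpM2l // [in leRHS](_ : - t = - m + (m - t)); last by ring.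
  by rewrite expRD ler_pM2l ?expR_gt0 // expR_ge1Dx.
have := tangent _ x0; have := tangent _ y0; have := tangent _ z0.
have := expR_gt0 (- m); set e := expR (- m) => e0.
by nra.
Qed.

(** * Replacing two classes of an optimal school *)

Definition learning {R : realType} (p : R) (k : nat) : R := k%:R * p ^+ k.

Lemma yield_learning (R : realType) (w : R) (k : nat) :
  yield (k%:R * w) = w * learning (expR (- w)) k.
Proof. by rewrite /yield /learning -mulrN expRM_natl mulrA (mulrC _ w). Qed.

Lemma profit_seq (R : realType) (p W : R) (m : nat) (n : m.-tuple nat) :
  profit p W n = \sum_(k <- n) learning p k - (size n)%:R * W.
Proof. by rewrite /profit size_tuple big_tuple. Qed.

Lemma class_size_vector_seq (Z m : nat) (n : m.-tuple nat) :
  class_size_vector Z n <->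
  [/\ (0 < size n)%N, all (leq 1) n & \sum_(k <- n) k = Z]%N.
Proof.
rewrite /class_size_vector size_tuple big_tuple.
by split=> -[m0 pos ->]; split=> //; apply/all_tnthP.
Qed.

(** Reassigning the students of two classes to new classes [t] yields an
    admissible school, so it cannot increase the profit; the contributions of all
    other classes cancel. Distinctness of the sizes [a] and [b] ensures that they
    are two different classes. *)
Lemma optimal_replace (R : realType) (Z : nat) (p W : R) (m : nat)
    (n : m.-tuple nat) (a b : nat) (t : seq nat) :
  optimal Z p W n -> a \in tval n -> b \in tval n -> a != b ->
  (0 < size t)%N -> all (leq 1) t -> (\sum_(k <- t) k = a + b)%N ->
  \sum_(k <- t) learning p k - (size t)%:R * W <=
    learning p a + learning p b - 2 * W.
Proof.
move=> [/class_size_vector_seq[_ pos sum] best _] an bn ab t0 tpos tsum.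
have [rest perm] : exists rest, perm_eq n (a :: b :: rest).
  have bn' : b \in rem a n.
    by move: bn; rewrite (perm_mem (perm_to_rem an)) inE eq_sym (negPf ab).
  exists (rem b (rem a n)); apply: perm_trans (perm_to_rem an) _.
  by rewrite perm_cons perm_to_rem.
move: pos; rewrite (perm_all _ perm) /= => /and3P[_ _ rpos].
have /best : class_size_vector Z (in_tuple (t ++ rest)).
  apply/class_size_vector_seq; split.
  - by rewrite size_cat ltn_addr.
  - by rewrite all_cat tpos.
  - by rewrite big_cat /= tsum -sum (perm_big _ perm) /= !big_cons addnA.
rewrite !profit_seq (perm_big _ perm) (perm_size perm) !big_cons big_cat /=.
by rewrite size_cat natrD -addn2 natrD; lra.
Qed.

(** Three times the sum of squares minus [s ^ 2] is the sum of the squared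
    pairwise differences, and among nearly equal parts at most two of these
    differences are nonzero. *)
Lemma near_equal_thirds (s : nat) : (3 <= s)%N -> exists x y z : nat,
  [/\ (0 < x)%N, (0 < y)%N, (0 < z)%N, (x + y + z = s)%N &
      (3 * (x ^ 2 + y ^ 2 + z ^ 2) <= s ^ 2 + 2)%N].
Proof.
move=> s3; have q0 : (0 < s %/ 3)%N by rewrite divn_gt0.
have := divn_eq s 3; have := ltn_pmod s (isT : (0 < 3)%N).
move: (s %/ 3)%N q0 (s %% 3)%N => q q0 [|[|[|//]]] _ ->.
- by exists q, q, q; split=> //; nia.
- by exists q, q, q.+1; split=> //; nia.
- by exists q, q.+1, q.+1; split=> //; nia.
Qed.

(** * Two uneven classes can be improved *)

(** The four lists tried for [t] are the merged class [[:: a + b]], the moved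
    student [[:: a.-1; b.+1]], and the two ways to employ a third teacher,
    [[:: b; b; a - b]] and a near-equal partition. *)
Lemma uneven_pair_improvable (R : realType) (p W : R) (a b : nat) :
  0 <= p <= 1 -> 0 < W -> (0 < b)%N -> (b.+2 <= a)%N ->
  ~ (forall t : seq nat,
       (0 < size t)%N -> all (leq 1) t -> (\sum_(k <- t) k = a + b)%N ->
       \sum_(k <- t) learning p k - (size t)%:R * W <=
         learning p a + learning p b - 2 * W).
Proof.
move=> + + b0 ba.
have a1 : (0 < a.-1)%N by lia.
have d0 : (0 < a - b)%N by lia.
have s0 : (0 < a + b)%N by lia.
have s3 : (3 <= a + b)%N by lia.
have a0 : (0 < a)%N by lia.
have moved : (a.-1 + b.+1 = a + b)%N by lia.
have halved : (b + b + (a - b) = a + b)%N by lia.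
have ba' : (b + (a - b) = a)%N by lia.
have d2 : (2 <= a - b)%N by lia.
move=> /andP[p0 p1] W0 best.
have merge : learning p (a + b)%N + W <= learning p a + learning p b.
  have := best [:: (a + b)%N] isT.
  by rewrite !big_seq1 /= s0 => /(_ isT erefl); lra.
have two x y : (0 < x)%N -> (0 < y)%N -> (x + y = a + b)%N ->
    learning p x + learning p y <= learning p a + learning p b.
  move=> x0 y0 xy; have := best [:: x; y] isT.
  by rewrite !big_cons !big_nil addn0 addr0 /= x0 y0 => /(_ isT xy); lra.
have three x y z : (0 < x)%N -> (0 < y)%N -> (0 < z)%N -> (x + y + z = a + b)%N ->
    learning p x + learning p y + learning p z <= learning p a + learning p b + W.
  move=> x0 y0 z0 xyz; have := best [:: x; y; z] isT.
  rewrite !big_cons !big_nil addn0 addnA addr0 /= x0 y0 z0 => /(_ isT xyz).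
  by lra.
have [p00|pn0] := eqVneq p 0.
  move: merge; rewrite /learning p00 !expr0n (gtn_eqF s0) (gtn_eqF a0) (gtn_eqF b0).
  by lra.
have [p11|pn1] := eqVneq p 1.
  by move: merge; rewrite /learning p11 !expr1n natrD; lra.
have {}p0 : 0 < p by rewrite lt_neqAle eq_sym pn0.
have {}p1 : p < 1 by rewrite lt_neqAle pn1.
pose w := - ln p.
have w0 : 0 < w by rewrite oppr_gt0 ln_lt0 // p0.
have pE : p = expR (- w) by rewrite opprK lnK.
clearbody w; subst p.
pose M := (a + b)%:R * w / 2; pose H := (a - b)%:R * w / 2.
have aR : a%:R = b%:R + (a - b)%:R :> R by rewrite -natrD ba'.
have dR : 2 <= (a - b)%:R :> R by rewrite ler_nat.
have bR : 1 <= b%:R :> R by rewrite ler1n.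
have HM : H < M by rewrite /H /M natrD aR; nra.
have aw : a%:R * w = M + H by rewrite /H /M natrD aR; field.
have bw : b%:R * w = M - H by rewrite /H /M natrD aR; field.
have wH : w <= H by rewrite /H; nra.
have sw : (a + b)%:R * w = 2 * M by rewrite /M; field.
have dw : (a - b)%:R * w = 2 * H by rewrite /H; field.
clearbody M H.
(* Moving one student replaces the half-gap [H] by [H - w]. *)
have M2 : 2 <= M.
  apply: (@spread_preferred_mean_ge2 R M H (H - w)); [lra|lra|].
  have := two a.-1 b.+1 a1 isT moved.
  rewrite -(ler_pM2l w0) !mulrDr -!yield_learning aw bw.
  have -> : a.-1%:R * w = M + (H - w).
    by rewrite -subn1 natrB ?(leq_trans _ ba) //; lra.
  have -> : b.+1%:R * w = M - (H - w) by rewrite -addn1 natrD; lra.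
  by lra.
have [Hhalf|/ltW Hhalf] := lerP (1 / 2) H.
  have := three b b (a - b)%N b0 b0 d0 halved => split.
  have : learning (expR (- w)) (a - b) + learning (expR (- w)) (a + b) <=
         2 * learning (expR (- w)) a by lra.
  rewrite -(ler_pM2l w0) !mulrDr (mulrCA w 2) -!yield_learning aw dw sw.
  have := split_beats_merge_of_spread _ _ _ M2 Hhalf HM.
  by lra.
have [x [y [z [x0 y0 z0 xyz sq]]]] := near_equal_thirds _ s3.
have : learning (expR (- w)) x + learning (expR (- w)) y +
    learning (expR (- w)) z + learning (expR (- w)) (a + b) <=
    2 * (learning (expR (- w)) a + learning (expR (- w)) b).
  by have := three x y z x0 y0 z0 xyz; lra.
rewrite -(ler_pM2l w0) (mulrCA w 2) !mulrDr -!yield_learning aw bw sw.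
have sumw : x%:R * w + y%:R * w + z%:R * w = 2 * M by rewrite -!mulrDl -!natrD xyz.
(* The rounding error is [2 * w ^+ 2 / 3], and [w <= H <= 1 / 2], whereas
   [2 * M / 24] is at least [1 / 6]. *)
have sqw : (x%:R * w) ^+ 2 + (y%:R * w) ^+ 2 + (z%:R * w) ^+ 2 <=
    (x%:R * w + y%:R * w + z%:R * w) * (2 * M / 3 + 1 / 24).
  have sqR : 3 * (x%:R ^+ 2 + y%:R ^+ 2 + z%:R ^+ 2) <= (a + b)%:R ^+ 2 + 2 :> R.
    by rewrite -!natrX -!natrD -natrM ler_nat.
  have : 3 * (x%:R ^+ 2 + y%:R ^+ 2 + z%:R ^+ 2) * w ^+ 2 <=
      ((a + b)%:R ^+ 2 + 2) * w ^+ 2 by rewrite ler_wpM2r ?sqr_ge0.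
  have : w ^+ 2 <= 1 / 4 by nra.
  have : ((a + b)%:R * w) ^+ 2 = (2 * M) ^+ 2 by rewrite sw.
  by rewrite sumw !exprMn; lra.
have nw k : 0 <= k%:R * w by rewrite mulr_ge0 ?ler0n ?(ltW w0).
have := jensen_three_yields _ _ _ _ _ (nw x) (nw y) (nw z) sqw; rewrite sumw.
have H0 : 0 <= H <= 1 / 2 by apply/andP; split; lra.
have := three_classes_beat_merge_of_close _ _ _ M2 H0.
by lra.
Qed.

Lemma nearly_equal_of_entries (m : nat) (n : m.-tuple nat) :
  (forall i j : 'I_m, (tnth n i <= (tnth n j).+1)%N) -> nearly_equal n.
Proof.
move=> close; rewrite /nearly_equal leq_subLR addn1.
(* The seed of the minimum is [max_size n] itself, for which the bound is
   trivial. *)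
rewrite /min_size; elim/big_ind: _ => [|x y hx hy|j _].
- exact: leqnSn.
- by rewrite /minn; case: ifP.
- by apply/bigmax_leqP => i _; apply: close.
Qed.

Theorem theorem18 (R : realType) (Z : nat) (p W : R)
    (hZ : (1 <= Z)%N) (hp : 0 <= p <= 1) (hW : 0 < W)
    (m : nat) (n : m.-tuple nat) (hn : optimal Z p W n) :
  nearly_equal n.
Proof.
apply: nearly_equal_of_entries => i j; rewrite leqNgt; apply/negP => far.
have [[_ pos _] _ _] := hn.
apply: (uneven_pair_improvable R p W (tnth n i) (tnth n j) hp hW (pos j) far).
move=> t; apply: optimal_replace hn _ _ _; rewrite ?mem_tnth //.
by rewrite gtn_eqF // ltnW.
Qed.
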